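(* Let $K$ be a number field with ring of integers $\mathcal{O}_K$. Let $I$ be a nonzero ideal of $\mathcal{O}_K$, and let $M$ be a finite set of nonzero integers. Assume that for all $a,b\in\mathcal{O}_K$ with $b\neq 0$ there exist $q\in\mathcal{O}_K$ and $r\in M$ such that \[ |N_{\mathcal{O}_K/\mathbf{Z}}(ra-qb)| < |N_{\mathcal{O}_K/\mathbf{Z}}(b)|. \] Then there exists an ideal $J$ of $\mathcal{O}_K$ such that $I\sim J$ and $J$ divides the principal ideal $\left\langle \prod_{m\in M} m\right\rangle$ of $\mathcal{O}_K$.
   Context: $N_{\mathcal{O}_K/\mathbf{Z}}$ denotes the (element) norm from $\mathcal{O}_K$ to $\mathbf{Z}$. For nonzero (fractional) ideals $I,J$ of $\mathcal{O}_K$, $I\sim J$ means there is a nonzero $\alpha\in K$ with $I=\langle\alpha\rangle J$, i.e. $I$ and $J$ define the same element of the ideal class group of $\mathcal{O}_K$. $\langle x\rangle$ denotes the ideal generated by $x$. *)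

(* Defs.v *)
From HB Require Import structures.
From mathcomp Require Import all_boot all_order all_algebra all_field.
From mathcomp Require Import finmap.
From mathcomp Require Import boolp classical_sets.

Set Implicit Arguments.
Unset Strict Implicit.
Unset Printing Implicit Defensive.

Import Order.TTheory GRing.Theory Num.Theory.

Local Open Scope ring_scope.
Local Open Scope classical_set_scope.

(* A number field is a [fieldExtType rat]; integral and fractional ideals of
   its ring of integers are represented as subsets of the field. *)

Definition ring_of_integers (K : fieldExtType rat) : set K :=
  [set x | integralOver (intr : int -> K) x].

(* The determinant does not depend on the basis. On the ring of integers this
   field norm takes integer values and is the norm down to Z. *)
Definition field_norm (K : fieldExtType rat) (x : K) : rat :=
  \det (passmx.mxof (vbasis {: K}) (vbasis {: K}) (amull x)).

Definition is_ideal (K : fieldExtType rat) (I : set K) : Prop :=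
  [/\ I `<=` @ring_of_integers K,
      I 0,
      forall x y, I x -> I y -> I (x + y)
    & forall c x, ring_of_integers c -> I x -> I (c * x)].

Definition is_nonzero_ideal (K : fieldExtType rat) (I : set K) : Prop :=
  is_ideal I /\ I <> [set 0].

(* The fractional ideal generated by an element of K; it is the usual principal
   ideal when x is integral. *)
Definition principal_ideal (K : fieldExtType rat) (x : K) : set K :=
  [set c * x | c in @ring_of_integers K].

Definition ideal_mul (K : fieldExtType rat) (I J : set K) : set K :=
  [set z | exists (n : nat) (a b : 'I_n -> K),
    [/\ forall i, I (a i), forall i, J (b i) & z = \sum_(i < n) a i * b i]].

Definition ideal_dvd (K : fieldExtType rat) (J I : set K) : Prop :=
  exists2 J' : set K, is_ideal J' & I = ideal_mul J J'.

Definition ideal_equiv (K : fieldExtType rat) (I J : set K) : Prop :=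
  exists2 alpha : K, alpha != 0 & I = ideal_mul (principal_ideal alpha) J.

(* Main.v *)
Require Import Defs.
From HB Require Import structures.
From mathcomp Require Import all_boot all_order all_algebra all_field.
From mathcomp Require Import perm finmap ring.
From mathcomp Require Import boolp classical_sets.

Set Implicit Arguments.
Unset Strict Implicit.
Unset Printing Implicit Defensive.

Import Order.TTheory GRing.Theory Num.Theory.

Local Open Scope ring_scope.
Local Open Scope classical_set_scope.

(* Let P be the product of M.  In a nonzero ideal A choose b <> 0 of minimal
   norm; the hypothesis gives, for every a in A, some r in M with r a in (b),
   so P A is contained in (b), and A = (b / P) L for an ideal L containing P.

   It remains to turn "P lies in L" into "L divides (P)".  Since O_K / P is
   finite, only finitely many ideals contain P, so two powers of L have the
   same representative: L^i = (a) N and L^j = (a') N with i < j and P in N.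
   Hence g N = N B with B = L^(j-i) and g = a' / a.  Elements stabilizing N are
   integral, so g^-1 B is an ideal, and Nakayama's lemma gives B = (g).  Then
   (P / g) L^(j-i-1) is the cofactor of L in (P).

   The finiteness of O_K / p for p prime needs no discriminant: integers of K
   that are independent modulo p are linearly independent over Q. *)

(** * Closure properties of the ring of integers *)

Lemma roi_int (K : fieldExtType rat) (m : int) :
  ring_of_integers (m%:~R : K).
Proof. exact: integral_id. Qed.

Lemma roi0 (K : fieldExtType rat) : ring_of_integers (0 : K).
Proof. exact: integral0. Qed.

Lemma roi1 (K : fieldExtType rat) : ring_of_integers (1 : K).
Proof. exact: integral1. Qed.

Lemma roiD (K : fieldExtType rat) (x y : K) :
  ring_of_integers x -> ring_of_integers y -> ring_of_integers (x + y).
Proof. exact: integral_add. Qed.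

Lemma roiN (K : fieldExtType rat) (x : K) :
  ring_of_integers x -> ring_of_integers (- x).
Proof. exact: integral_opp. Qed.

Lemma roiB (K : fieldExtType rat) (x y : K) :
  ring_of_integers x -> ring_of_integers y -> ring_of_integers (x - y).
Proof. exact: integral_sub. Qed.

Lemma roiM (K : fieldExtType rat) (x y : K) :
  ring_of_integers x -> ring_of_integers y -> ring_of_integers (x * y).
Proof. exact: integral_mul. Qed.

Lemma roi_sum (K : fieldExtType rat) (T : Type) (r : seq T) (P : pred T)
    (F : T -> K) :
  (forall i, P i -> ring_of_integers (F i)) ->
  ring_of_integers (\sum_(i <- r | P i) F i).
Proof. by move=> FO; apply: big_ind FO; [exact: roi0 | exact: roiD]. Qed.

(** With [c] the given integral difference, [x] is a root of the monic polynomial X^j - (X^i + c),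
    whose coefficients are integral; transitivity of integrality concludes. *)
Lemma roi_subX (K : fieldExtType rat) (x : K) (i j : nat) :
  (i < j)%N -> ring_of_integers (x ^+ j - x ^+ i) -> ring_of_integers x.
Proof.
move=> lt_ij Oc; set c := x ^+ j - x ^+ i in Oc.
have szX : (size ('X^i + c%:P : {poly K})%R <= j)%N.
  rewrite (leq_trans (size_polyD _ _))// geq_max size_polyXn lt_ij/=.
  by rewrite (leq_trans (size_polyC_leq1 _))// (leq_trans _ lt_ij).
apply: (@integral_root_monic _ _ _ x ('X^j - ('X^i + c%:P))).
- rewrite monicE lead_coefDl ?lead_coefXn// size_polyXn size_polyN.
  by rewrite ltnS.
- rewrite rootE hornerD hornerN hornerD !hornerXn hornerC.
  by rewrite [x ^+ i + _]addrC subrK subrr.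
- apply/integral_poly => k; rewrite !coefE.
  by apply/roiB; [|apply/roiD; [|case: ifP => _ //; exact: roi0]];
    exact: integral_nat.
Qed.

(** * Integrality of the norm *)

(** Up to sign the norm is the product of the eigenvalues in [algC] of multiplication by [x]. Each
    one is a root of a monic integer polynomial killing [x], so the norm is a rational algebraic
    integer. *)
Lemma field_norm_int (K : fieldExtType rat) (x : K) :
  ring_of_integers x -> field_norm x \is a Num.int.
Proof.
move=> [p mon_p px0].
pose e := vbasis {: K}.
have be : basis_of {: K} e := vbasisP _.
pose mx (y : K) : 'M[algC]_(\dim {: K}) :=
  map_mx ratr (passmx.mxof e e (amull y)).
have mxM y z : mx (y * z) = mx y *m mx z.
  by rewrite /mx mulrC amullM -map_mxM -passmx.mxof_comp.
have mx1 : mx 1 = 1%:M.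
  by rewrite /mx amull1 passmx.mxof1 ?map_mx1// (basis_free be).
have mxL a y z : mx (a *: y + z) = ratr a *: mx y + mx z.
  rewrite /mx (amull_is_linear a y z).
  by rewrite passmx.mxof_linear map_mxD map_mxZ.
have mxD y z : mx (y + z) = mx y + mx z.
  by have := mxL 1 y z; rewrite rmorph1 !scale1r.
have mx0 : mx 0 = 0.
  by have := mxL (-1) 0 0; rewrite scaler0 add0r rmorphN1 scaleN1r addNr.
have mxZ (m : int) y : mx (m%:~R * y) = m%:~R *: mx y.
  rewrite mulrzl -scaler_int -[_ *: y]addr0 mxL mx0 addr0.
  by rewrite rmorph_int.
have root_int l : root (char_poly (mx x)) l -> l \in Aint.
  rewrite -eigenvalue_root_char => /eigenvalueP[v vl v0].
  have vX k : v *m mx (x ^+ k) = l ^+ k *: v.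
    elim: k => [|k IH]; first by rewrite mx1 mulmx1 expr0 scale1r.
    by rewrite exprSr mxM mulmxA IH -scalemxAl vl scalerA exprSr.
  apply: (@root_monic_Aint (map_poly intr p)); last 2 first.
  - by rewrite monic_map.
  - by apply/polyOverP => i; rewrite coef_map/= intr_int.
  (* By [vX], the matrix of p(x) = 0 acts on the eigenvector [v] as the scalar p(l). *)
  have : (map_poly intr p).[l] *: v = 0.
    rewrite -[RHS](mulmx0 _ v) -mx0 -(rootP px0) !horner_coef.
    rewrite !size_map_poly_id0 ?(monicP mon_p) ?rmorph1 ?oner_neq0//.
    rewrite scaler_suml (big_morph mx mxD mx0) mulmx_sumr.
    apply: eq_bigr => i _; rewrite !coef_map/= mxZ -scalemxAr vX scalerA.
    by [].
  by move/eqP; rewrite scaler_eq0 (negPf v0) orbF.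
suff : ratr (field_norm x) \is a @Num.int algC.
  move/intrP => [m]; rewrite -[m%:~R]ratr_int => /fmorph_inj->.
  exact: intr_int.
apply: Cint_rat_Aint; first exact: Crat_rat.
have -> : ratr (field_norm x) = \det (mx x) :> algC.
  by rewrite /field_norm -det_map_mx.
have [r rE] := closed_field_poly_normal (char_poly (mx x)).
have := char_poly_det (mx x).
move/(congr1 (fun z => (-1) ^+ \dim {: K} * z)).
rewrite mulrA -exprMn mulrNN mulr1 expr1n mul1r => <-.
apply: rpredM; first by rewrite rpredX// rpredN rpred1.
move: rE; rewrite (monicP (char_poly_monic _)) scale1r => rE.
rewrite -horner_coef0 rE horner_prod big_seq; apply: rpred_prod => z zr.
rewrite hornerXsubC sub0r rpredN root_int// rE root_prod_XsubC.
by [].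
Qed.

(** * Finiteness of the quotients of the ring of integers *)

Lemma intr_fieldExt_eq0 (K : fieldExtType rat) (m : int) :
  ((m%:~R : K) == 0) = (m == 0).
Proof.
rewrite -(scaler_int m (1 : K)) scaler_eq0 (oner_eq0 K) orbF.
by rewrite intr_eq0.
Qed.

Lemma rat_common_denominator (k : nat) (c : 'I_k -> rat) :
  exists2 d : int, d != 0 & exists a : 'I_k -> int,
    forall i, d%:~R * c i = (a i)%:~R.
Proof.
exists (\prod_i denq (c i)).
  by apply/prodf_neq0 => i _; rewrite denq_neq0.
exists (fun i => numq (c i) * \prod_(j | j != i) denq (c j)) => i.
by rewrite (bigD1 i)//= !intrM numqE; ring.
Qed.

(** For [p] prime this is linear independence over F_p in O_K / p, phrased without forming the
    quotient. *)
Definition indep_mod (K : fieldExtType rat) (p k : nat) (x : 'I_k -> K) :=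
  (forall i, ring_of_integers (x i)) /\
  forall (c : 'I_k -> int) (z : K), ring_of_integers z ->
    \sum_i (c i)%:~R * x i = p%:R * z -> forall i, (p %| c i)%Z.

(* A nontrivial integral relation would be divisible by every power of [p]. *)
Lemma indep_mod_leq_dim (K : fieldExtType rat) (p k : nat) (x : 'I_k -> K) :
  (1 < p)%N -> indep_mod p x -> (k <= \dim {: K})%N.
Proof.
move=> p1 [Ox indx].
have pn0 : p%:Z != 0 by case: p p1 {indx}.
have dvd_all n : forall c : 'I_k -> int, \sum_i (c i)%:~R * x i = 0 ->
    forall i, ((p ^ n)%N %| c i)%Z.
  elim: n => [|n IH] c c0 i; first by rewrite expn0 dvd1z.
  have pc j : (p %| c j)%Z.
    by apply: (indx c 0 (roi0 K)); rewrite mulr0.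
  (* Dividing all coefficients by [p] leaves a relation, to which [IH] applies. *)
  have ->: c i = p%:Z * (c i %/ p)%Z by rewrite mulrC divzK.
  rewrite expnS PoszM dvdz_mul2l//.
  apply: (IH (fun j => (c j %/ p)%Z)).
  have pK : (p%:Z%:~R : K) != 0 by rewrite intr_fieldExt_eq0.
  apply: (mulfI pK); rewrite mulr0 -[RHS]c0 mulr_sumr.
  by apply: eq_bigr => j _; rewrite mulrA -intrM [p%:Z * _]mulrC divzK.
have fr : free [tuple x i | i < k].
  apply/freeP => c.
  have [d d0 [a ha]] := rat_common_denominator c.
  move=> c0 i; apply: (mulfI (_ : d%:~R != 0 :> rat)).
    by rewrite intr_eq0.
  rewrite mulr0 ha; apply/eqP; rewrite intr_eq0.
  have: forall n, ((p ^ n)%N %| a i)%Z.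
    move=> n; apply: dvd_all.
    rewrite -[RHS](scaler0 _ (d%:~R : rat)) -[in RHS]c0 scaler_sumr.
    apply: eq_bigr => j _; rewrite scalerA ha scaler_int -mulrzl.
    by rewrite -tnth_nth tnth_mktuple mulr1 mulrzl.
  (* The exponent |a i| suffices: p^|a i| > |a i| excludes divisibility unless [a i] is zero. *)
  move/(_ `|a i|%N); rewrite dvdzE/= => /dvdn_leq; case: eqP => // /eqP ai0.
  by rewrite absz_gt0 ai0 leqNgt ltn_expl// => /(_ isT).
by move: fr => /eqP; rewrite size_tuple => <-; rewrite dimvS ?subvf.
Qed.

(** The dimension bound yields an independent family modulo [p] of maximal length. It spans O_K / p,
    so its combinations with coefficients in [0, p) represent all classes. *)
Lemma roi_quotient_prime_finite (K : fieldExtType rat) (p : nat) : prime p ->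
  exists2 s : seq K, {in s, forall y, ring_of_integers y} &
    forall x : K, ring_of_integers x ->
    exists2 y, y \in s & exists2 z, ring_of_integers z & x = y + p%:R * z.
Proof.
move=> p_pr; have p1 := prime_gt1 p_pr.
have pn0 : p%:Z != 0 by case: p p1 {p_pr}.
pose Q k := `[< exists x : 'I_k -> K, indep_mod p x >].
have exQ : exists k, Q k.
  by exists 0%N; apply/asboolP; exists (fun=> 0); split => [|c z _ _] [].
have Qle k : Q k -> (k <= \dim {: K})%N.
  by move=> /asboolP[x]; exact: indep_mod_leq_dim.
case: (ex_maxnP exQ Qle) => k /asboolP[x [Ox indx]] kmax.
exists [seq \sum_i (f i)%:R * x i | f : {ffun 'I_k -> 'I_p}].
  move=> y /mapP[f _ ->]; apply: roi_sum => i _; apply: roiM => //.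
  exact: (roi_int _ (f i)).
move=> y Oy.
pose x' (i : 'I_k.+1) := oapp x y (unlift ord0 i).
(* By maximality, putting [y] in front of the family destroys independence. *)
have : ~ indep_mod p x'.
  move=> indx'; have := kmax k.+1; rewrite ltnn => F.
  by apply/notF/F/asboolP; exists x'.
move=> /not_andP[/existsNP[i]|].
  by rewrite /x'; case: unlift => [j|] /=; [case; exact: Ox | case].
move=> /existsNP[c /existsNP[z /not_implyP[Oz]]].
move=> /not_implyP[cz /existsNP[i0 ci0]].
rewrite big_ord_recl /x' unlift_none/= in cz.
have {}cz : (c ord0)%:~R * y + \sum_i (c (lift ord0 i))%:~R * x i = p%:R * z.
  by rewrite -cz; congr (_ + _); apply: eq_bigr => i _; rewrite liftK.
(* Otherwise the term in [y] is absorbed into the multiple of [p], and independence of [x] makes [p]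
   divide every coefficient, against [ci0]. *)
have pc0 : ~~ (p %| c ord0)%Z.
  apply/negP => pc0; have cE : c ord0 = (c ord0 %/ p)%Z * p by rewrite divzK.
  case: (unliftP ord0 i0) ci0 => [j ->|->] //; apply; move: j.
  apply: (indx (fun j => c (lift ord0 j)) (z - (c ord0 %/ p)%Z%:~R * y)).
    by apply: roiB => //; apply: roiM => //; exact: roi_int.
  rewrite mulrBr -cz {1}cE intrM [p%:R * _]mulrA [p%:R * _]mulrC.
  by rewrite addrAC subrr add0r.
have cop : coprimez (c ord0) p.
  by rewrite coprimez_sym coprimezE prime_coprime.
have [[u v] /= uv1] := coprimezP _ _ cop.
(* Multiplying the relation by [u], the inverse of [c ord0] modulo [p], gives y = sum e_i x_i + p (u
   z + v y). The remainders of the [e i] choose the representative; their quotients join the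
   multiple of [p]. *)
pose e i := - u * c (lift ord0 i).
have em i : (`|(e i %% p)%Z|%N < p)%N.
  by rewrite -ltz_nat gez0_abs ?modz_ge0// ltz_pmod// ltz_nat ltnW.
exists (\sum_i ([ffun i => Ordinal (em i)] i)%:R * x i).
  exact/map_f/mem_enum.
exists (u%:~R * z + v%:~R * y + \sum_i (e i %/ p)%Z%:~R * x i).
  apply: roiD; first by apply: roiD; apply: roiM => //; exact: roi_int.
  by apply: roi_sum => i _; apply: roiM => //; exact: roi_int.
rewrite mulrDr addrCA mulr_sumr -big_split/=.
have -> : \sum_i (([ffun i => Ordinal (em i)] i)%:R * x i +
     p%:R * ((e i %/ p)%Z%:~R * x i)) = \sum_i (e i)%:~R * x i.
  apply: eq_bigr => i _; rewrite ffunE/= mulrA -mulrDl; congr (_ * _).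
  rewrite -[p%:R]/(p%:Z%:~R) -[X in X + _]/((Posz _)%:~R) -intrM -intrD.
  rewrite gez0_abs ?modz_ge0//.
  by rewrite addrC mulrC -divz_eq.
have -> : \sum_i (e i)%:~R * x i = - u%:~R * \sum_i (c (lift ord0 i))%:~R * x i.
  by rewrite mulr_sumr; apply: eq_bigr => i _; rewrite /e intrM mulrNz mulrA.
set S := \sum_i _ in cz *.
have {}uv1 : u%:~R * (c ord0)%:~R + v%:~R * p%:R = 1 :> K.
  by rewrite -[p%:R]/(p%:Z%:~R) -!intrM -intrD uv1.
rewrite mulrDr [p%:R * (u%:~R * z)]mulrCA -cz -{1}[y]mul1r -{1}uv1; ring.
Qed.

(** Induction splitting off a prime factor [p]: reduce modulo [p], then reduce the cofactor modulo m
    / p. *)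
Lemma roi_quotient_nat_finite (K : fieldExtType rat) (m : nat) : (0 < m)%N ->
  exists2 s : seq K, {in s, forall y, ring_of_integers y} &
    forall x : K, ring_of_integers x ->
    exists2 y, y \in s & exists2 z, ring_of_integers z & x = y + m%:R * z.
Proof.
elim/ltn_ind: m => m IH m0; have [m1|m1] := leqP m 1.
  have -> : m = 1%N by case: m m0 m1 {IH} => [|[]].
  exists [:: 0] => [y|x Ox]; first by rewrite inE => /eqP->; exact: roi0.
  by exists 0; rewrite ?inE//; exists x; rewrite // add0r mul1r.
have pp := pdiv_prime m1; set p := pdiv m in pp.
have pm : (p * (m %/ p) = m)%N by rewrite mulnC divnK// pdiv_dvd.
have [s1 Os1 hs1] := roi_quotient_prime_finite K pp.
have [||s2 Os2 hs2] := IH (m %/ p)%N.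
- by rewrite ltn_Pdiv// prime_gt1.
- by move: m0; rewrite -{1}pm muln_gt0 => /andP[].
exists [seq y + p%:R * z | y <- s1, z <- s2].
  move=> w /allpairsP[[y z]/= [/Os1 Oy /Os2 Oz ->]].
  by apply: roiD => //; apply: roiM => //; exact: (roi_int _ p).
move=> x /hs1[y ys1 [z /hs2[w ws2 [t Ot ->]] ->]].
exists (y + p%:R * w); first exact: allpairs_f.
by exists t => //; rewrite -[X in _ = _ + X%:R * _]pm natrM mulrDr addrA mulrA.
Qed.

Lemma roi_quotient_finite (K : fieldExtType rat) (m : int) : m != 0 ->
  exists2 s : seq K, {in s, forall y, ring_of_integers y} &
    forall x : K, ring_of_integers x ->
    exists2 y, y \in s & exists2 z, ring_of_integers z & x = y + m%:~R * z.
Proof.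
move=> m0; have [|s Os hs] := @roi_quotient_nat_finite K `|m|%N.
  by rewrite absz_gt0.
exists s => // x /hs[y ys [z Oz ->]]; exists y => //.
exists ((Num.sg m)%:~R * z); first by apply: roiM => //; exact: roi_int.
by rewrite mulrA -intrM mulrC [m * _]mulrC -abszEsg mulrC.
Qed.

(** * Ideals, their multiples, products and powers *)

Lemma idealZ (K : fieldExtType rat) (A : set K) (c x : K) :
  is_ideal A -> ring_of_integers c -> A x -> A (c * x).
Proof. by case=> _ _ _; exact. Qed.

Lemma idealD (K : fieldExtType rat) (A : set K) (x y : K) :
  is_ideal A -> A x -> A y -> A (x + y).
Proof. by case=> _ _ AD _; exact: AD. Qed.

Lemma idealB (K : fieldExtType rat) (A : set K) (x y : K) :
  is_ideal A -> A x -> A y -> A (x - y).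
Proof.
move=> iA Ax Ay; apply: idealD => //; rewrite -mulN1r.
by apply: idealZ => //; apply/roiN/roi1.
Qed.

Lemma is_ideal_roi (K : fieldExtType rat) : is_ideal (@ring_of_integers K).
Proof. by split=> //; [exact: roi0 | exact: roiD | exact: roiM]. Qed.

Lemma ideal_eq_roi (K : fieldExtType rat) (A : set K) :
  is_ideal A -> A 1 -> A = @ring_of_integers K.
Proof.
move=> iA A1; rewrite eqEsubset; split; first by case: iA.
by move=> x Ox; rewrite -[x]mulr1; apply: idealZ.
Qed.

(** Allowing any [a] in [K] covers fractional ideals too. *)
Definition scale_set (K : fieldExtType rat) (a : K) (A : set K) : set K :=
  [set a * x | x in A].

Lemma scale_setA (K : fieldExtType rat) (a b : K) (A : set K) :
  scale_set a (scale_set b A) = scale_set (a * b) A.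
Proof.
rewrite eqEsubset; split=> [_ [_ [x Ax <-] <-]|_ [x Ax <-]].
  by exists x; rewrite ?mulrA.
by exists (b * x); [exists x | rewrite mulrA].
Qed.

Lemma scale_set1 (K : fieldExtType rat) (A : set K) : scale_set 1 A = A.
Proof.
rewrite eqEsubset; split=> [_ [x Ax <-]|x Ax]; first by rewrite mul1r.
by exists x; rewrite ?mul1r.
Qed.

Lemma principal_idealE (K : fieldExtType rat) (a : K) :
  principal_ideal a = scale_set a (@ring_of_integers K).
Proof.
by rewrite eqEsubset; split=> _ [x Ox <-]; exists x; rewrite // mulrC.
Qed.

Lemma is_ideal_scale (K : fieldExtType rat) (a : K) (A : set K) :
  is_ideal A -> scale_set a A `<=` @ring_of_integers K ->
  is_ideal (scale_set a A).
Proof.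
move=> iA aAO; split=> //.
- by exists 0; [case: iA | rewrite mulr0].
- move=> _ _ [x Ax <-] [y Ay <-]; exists (x + y); first exact: idealD.
  by rewrite mulrDr.
- move=> c _ Oc [x Ax <-]; exists (c * x); first exact: idealZ.
  by rewrite mulrCA.
Qed.

Lemma ideal_mul_mem (K : fieldExtType rat) (A B : set K) (x y : K) :
  A x -> B y -> ideal_mul A B (x * y).
Proof.
move=> Ax By; exists 1%N, (fun=> x), (fun=> y); split=> //.
by rewrite big_ord1.
Qed.

Lemma ideal_mul0 (K : fieldExtType rat) (A B : set K) : ideal_mul A B 0.
Proof.
by exists 0%N, (fun=> 0), (fun=> 0); split=> [[]|[]|] //; rewrite big_ord0.
Qed.

Lemma ideal_mulD (K : fieldExtType rat) (A B : set K) (x y : K) :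
  ideal_mul A B x -> ideal_mul A B y -> ideal_mul A B (x + y).
Proof.
move=> [n [a [b [Aa Bb ->]]]] [n' [a' [b' [Aa' Bb' ->]]]].
pose glue (f : 'I_n -> K) (g : 'I_n' -> K) (i : 'I_(n + n')) :=
  match split i with inl j => f j | inr j => g j end.
exists (n + n')%N, (glue a a'), (glue b b'); split.
- by move=> i; rewrite /glue; case: split.
- by move=> i; rewrite /glue; case: split.
- rewrite big_split_ord/=; congr (_ + _); apply: eq_bigr => i _.
    by rewrite /glue (unsplitK (inl i : 'I_n + 'I_n')).
  by rewrite /glue (unsplitK (inr i : 'I_n + 'I_n')).
Qed.

(** Induction principle for products, which spares later proofs the explicit sums. *)
Lemma ideal_mul_sub (K : fieldExtType rat) (A B T : set K) :
  T 0 -> (forall x y, T x -> T y -> T (x + y)) ->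
  (forall x y, A x -> B y -> T (x * y)) -> ideal_mul A B `<=` T.
Proof.
move=> T0 TD TM _ [n [a [b [Aa Bb ->]]]].
by apply: big_ind => // i _; exact: TM.
Qed.

Lemma ideal_mulC (K : fieldExtType rat) (A B : set K) :
  ideal_mul A B = ideal_mul B A.
Proof.
have sub (C D : set K) : ideal_mul C D `<=` ideal_mul D C.
  apply: ideal_mul_sub; [exact: ideal_mul0 | exact: ideal_mulD|].
  by move=> x y Cx Dy; rewrite mulrC; exact: ideal_mul_mem.
by rewrite eqEsubset.
Qed.

Lemma ideal_mulA (K : fieldExtType rat) (A B C : set K) :
  ideal_mul A (ideal_mul B C) = ideal_mul (ideal_mul A B) C.
Proof.
have sub (D E F : set K) :
    ideal_mul (ideal_mul D E) F `<=` ideal_mul D (ideal_mul E F).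
  apply: ideal_mul_sub; [exact: ideal_mul0 | exact: ideal_mulD|].
  move=> x f + Ff; move: x.
  apply: (@ideal_mul_sub _ _ _ [set x | ideal_mul D (ideal_mul E F) (x * f)]).
  - by rewrite /= mul0r; exact: ideal_mul0.
  - by move=> x y /= Dx Dy; rewrite mulrDl; exact: ideal_mulD.
  - move=> x y Dx Ey /=; rewrite -mulrA; do 2!apply: ideal_mul_mem => //.
rewrite eqEsubset; split; last exact: sub.
rewrite ideal_mulC [ideal_mul B C]ideal_mulC [X in _ `<=` X]ideal_mulC.
by rewrite [ideal_mul A B]ideal_mulC; exact: sub.
Qed.

Lemma ideal_mul_scalel (K : fieldExtType rat) (a : K) (A B : set K) :
  ideal_mul (scale_set a A) B = scale_set a (ideal_mul A B).
Proof.
rewrite eqEsubset; split.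
  apply: ideal_mul_sub.
  - by exists 0; [exact: ideal_mul0 | rewrite mulr0].
  - move=> _ _ [x xAB <-] [y yAB <-]; exists (x + y); last by rewrite mulrDr.
    exact: ideal_mulD.
  - move=> _ y [x Ax <-] By; exists (x * y); last by rewrite mulrA.
    exact: ideal_mul_mem.
move=> _ [x xAB <-]; move: x xAB.
apply: (@ideal_mul_sub _ _ _ [set x | ideal_mul (scale_set a A) B (a * x)]).
- by rewrite /= mulr0; exact: ideal_mul0.
- by move=> x y /= Dx Dy; rewrite mulrDr; exact: ideal_mulD.
- move=> x y Ax By /=; rewrite mulrA; apply: ideal_mul_mem => //.
  by exists x.
Qed.

Lemma ideal_mul_scaler (K : fieldExtType rat) (a : K) (A B : set K) :
  ideal_mul A (scale_set a B) = scale_set a (ideal_mul A B).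
Proof. by rewrite ideal_mulC ideal_mul_scalel ideal_mulC. Qed.

Lemma ideal_mul_roil (K : fieldExtType rat) (A : set K) :
  is_ideal A -> ideal_mul (@ring_of_integers K) A = A.
Proof.
move=> iA; rewrite eqEsubset; split=> [|x Ax]; last first.
  by rewrite -[x]mul1r; apply: ideal_mul_mem => //; exact: roi1.
by apply: ideal_mul_sub; case: iA.
Qed.

Lemma is_ideal_mul (K : fieldExtType rat) (A B : set K) :
  is_ideal A -> is_ideal B -> is_ideal (ideal_mul A B).
Proof.
move=> iA iB; have [AO _ _ _] := iA; have [BO _ _ _] := iB; split.
- apply: ideal_mul_sub; [exact: roi0 | exact: roiD |].
  by move=> x y /AO Ox /BO Oy; exact: roiM.
- exact: ideal_mul0.
- exact: ideal_mulD.
- move=> c x Oc ABx; rewrite -(ideal_mul_roil iA) -ideal_mulA.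
  exact: ideal_mul_mem.
Qed.

Fixpoint ideal_pow (K : fieldExtType rat) (A : set K) (n : nat) : set K :=
  if n is n'.+1 then ideal_mul A (ideal_pow A n') else @ring_of_integers K.

Lemma is_ideal_pow (K : fieldExtType rat) (A : set K) (n : nat) :
  is_ideal A -> is_ideal (ideal_pow A n).
Proof.
move=> iA; elim: n => [|n IH] /=; first exact: is_ideal_roi.
exact: is_ideal_mul.
Qed.

Lemma ideal_powD (K : fieldExtType rat) (A : set K) (m n : nat) :
  is_ideal A ->
  ideal_pow A (m + n) = ideal_mul (ideal_pow A m) (ideal_pow A n).
Proof.
move=> iA; elim: m => [|m IH]; last by rewrite addSn /= IH ideal_mulA.
by rewrite ideal_mul_roil//; exact: is_ideal_pow.
Qed.

Lemma ideal_pow_mem (K : fieldExtType rat) (A : set K) (n : nat) (x : K) :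
  A x -> ideal_pow A n (x ^+ n).
Proof.
move=> Ax; elim: n => [|n IH] /=; first by rewrite expr0; exact: roi1.
by rewrite exprS; exact: ideal_mul_mem.
Qed.

(** * Consequences of finiteness modulo [m] *)

Lemma nat_pigeonhole (T : finType) (f : nat -> T) :
  exists i j, (i < j)%N /\ f i = f j.
Proof.
have /injectivePn[i [j ij fij]] : ~~ injectiveb (fun i : 'I_#|T|.+1 => f i).
  apply/negP => /injectiveP/leq_card; rewrite card_ord.
  by rewrite ltnn.
have : nat_of_ord i != j by rewrite (inj_eq val_inj).
by rewrite neq_ltn => /orP[] ?; [exists i, j | exists j, i].
Qed.

(** An ideal containing [m] is a union of classes modulo [m], hence determined by which
    representatives it contains: finitely many patterns. *)
Lemma ideal_sequence_repeats (K : fieldExtType rat) (m : int)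
    (L : nat -> set K) : m != 0 ->
  (forall k, is_ideal (L k)) -> (forall k, L k m%:~R) ->
  exists i j, (i < j)%N /\ L i = L j.
Proof.
move=> m0 iL Lm; have [s Os hs] := @roi_quotient_finite K m m0.
have [i [j [lt_ij eq_ij]]] :=
  nat_pigeonhole (fun k => [ffun h : 'I_(size s) => `[< L k s`_h >]]).
exists i, j; split=> //.
have memL k y z : ring_of_integers z -> L k (y + m%:~R * z) <-> L k y.
  move=> Oz; have Lmz : L k (m%:~R * z) by rewrite mulrC; apply: idealZ.
  split=> [yL|yL]; last exact: idealD.
  by rewrite -[y](addrK (m%:~R * z)); apply: idealB.
have memij y : y \in s -> L i y <-> L j y.
  move=> ys; have ysz : (index y s < size s)%N by rewrite index_mem.
  move/ffunP/(_ (Ordinal ysz)): eq_ij; rewrite !ffunE/= nth_index//.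
  exact: asbool_eq_equiv.
rewrite eqEsubset; split=> x Lx; have Ox : ring_of_integers x.
- by case: (iL i) => + _ _ _; exact.
- have [y ys [z Oz xE]] := hs x Ox; rewrite xE in Lx *.
  by apply/(memL _ y z Oz)/(memij y ys)/(memL _ y z Oz).
- by case: (iL j) => + _ _ _; exact.
- have [y ys [z Oz xE]] := hs x Ox; rewrite xE in Lx *.
  by apply/(memL _ y z Oz)/(memij y ys)/(memL _ y z Oz).
Qed.

(* The elements [m * beta ^+ k] all lie in the ring of integers, hence two of
   them agree modulo [m]; this makes [beta] integral over it. *)
Lemma ideal_stabilizer_integral (K : fieldExtType rat) (m : int) (J : set K)
    (beta : K) : m != 0 -> is_ideal J -> J m%:~R ->
  (forall x, J x -> J (beta * x)) -> ring_of_integers beta.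
Proof.
move=> m0 iJ Jm stab; have [s Os hs] := @roi_quotient_finite K m m0.
have JO : J `<=` @ring_of_integers K by case: iJ.
have Jk k : J (beta ^+ k * m%:~R).
  elim: k => [|k IH]; first by rewrite mul1r.
  by rewrite exprS -mulrA; exact: stab.
have /choice[f hf] : forall k, exists h : 'I_(size s),
    exists2 z, ring_of_integers z & beta ^+ k * m%:~R = s`_h + m%:~R * z.
  move=> k; have [y ys [z Oz kE]] := hs _ (JO _ (Jk k)).
  have ysz : (index y s < size s)%N by rewrite index_mem.
  by exists (Ordinal ysz); exists z; rewrite //= nth_index.
have [i [j [lt_ij fij]]] := nat_pigeonhole f.
apply: (roi_subX lt_ij).
have [zi Ozi iE] := hf i; have [zj Ozj jE] := hf j.
have mK : (m%:~R : K) != 0 by rewrite intr_fieldExt_eq0.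
suff -> : beta ^+ j - beta ^+ i = zj - zi by exact: roiB.
apply: (mulIf mK); rewrite mulrBl iE jE fij; ring.
Qed.

(** Generators are [m] and those representatives modulo [m] that lie in [J]. *)
Lemma ideal_finitely_generated (K : fieldExtType rat) (m : int) (J : set K) :
  m != 0 -> is_ideal J -> J m%:~R ->
  exists (n : nat) (c : 'I_n -> K), (forall i, J (c i)) /\
    forall x, J x -> exists2 o : 'I_n -> K,
      forall i, ring_of_integers (o i) & x = \sum_i o i * c i.
Proof.
move=> m0 iJ Jm; have [s Os hs] := @roi_quotient_finite K m m0.
pose t := m%:~R :: [seq y <- s | `[< J y >]].
exists (size t), (fun i => t`_i); split=> [i|x Jx].
  have : t`_i \in t by rewrite mem_nth.
  rewrite inE => /orP[/eqP-> //|].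
  by rewrite mem_filter => /andP[/asboolP].
have Ox : ring_of_integers x by case: iJ => + _ _ _; exact.
have [y ys [z Oz xE]] := hs x Ox.
have yt : y \in t.
  rewrite inE mem_filter ys andbT; apply/orP; right; apply/asboolP.
  have -> : y = x - z * m%:~R by rewrite xE; ring.
  by apply: idealB => //; apply: idealZ.
have yi : (index y t < size t)%N by rewrite index_mem.
(* Index [ord0] carries [m]. Adding two such families stays correct even if [y] equals [m]. *)
pose delta (k : 'I_(size t)) w (i : 'I_(size t)) : K := if i == k then w else 0.
have sum_delta k w : \sum_i delta k w i * t`_i = w * t`_k.
  rewrite (bigD1 k)//= big1 ?addr0 /delta ?eqxx// => i /negPf->.
  by rewrite mul0r.
have Odelta k w i : ring_of_integers w -> ring_of_integers (delta k w i).
  by rewrite /delta; case: eqP => // _ _; exact: roi0.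
exists (fun i => delta ord0 z i + delta (Ordinal yi) 1 i) => [i|].
  by apply: roiD; apply: Odelta => //; exact: roi1.
under eq_bigr do rewrite mulrDl.
rewrite big_split/= !sum_delta (nth_index _ yt) xE /=; ring.
Qed.

(** * The determinant trick and cancellation *)

(** Modulo [B] the matrix is the identity, so the Leibniz expansions agree term by term. *)
Lemma det_1sub_ideal (K : fieldExtType rat) (B : set K) (n : nat)
    (b : 'M[K]_n) :
  is_ideal B -> (forall i j, B (b i j)) -> B (1 - \det (1%:M - b)).
Proof.
move=> iB Bb; have BO : B `<=` @ring_of_integers K by case: iB.
have O1 (i j : 'I_n) : ring_of_integers ((1%:M : 'M[K]_n) i j).
  by rewrite mxE; exact: integral_nat.
rewrite -{1}(det1 K n) /determinant -sumrB.
apply: big_ind => [||s _]; first by case: iB.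
  by move=> x y; exact: idealD.
rewrite -mulrBr; apply: idealZ => //.
  by rewrite -signr_odd; case: odd; [apply: roiN|]; exact: roi1.
(* Congruence modulo [B] passes to products only between integral elements, so [R] records
   integrality. *)
pose R (x y : K) := [/\ ring_of_integers x, ring_of_integers y & B (x - y)].
suff [] : R (\prod_i (1%:M : 'M[K]_n) i (s i))
            (\prod_i (1%:M - b : 'M[K]_n) i (s i)) by [].
apply: (big_ind2 R).
- by split; [exact: roi1 | exact: roi1 | rewrite subrr; case: iB].
- move=> x x' y y' [Ox Ox' Bx] [Oy Oy' By]; split; [exact: roiM|exact: roiM|].
  have -> : x * y - x' * y' = y * (x - x') + x' * (y - y') by ring.
  by apply: idealD => //; apply: idealZ.
- move=> i _; split=> //.
    by rewrite !mxE; apply: roiB; [exact: integral_nat | exact/BO].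
  have -> : (1%:M : 'M[K]_n) i (s i) - (1%:M - b : 'M[K]_n) i (s i) = b i (s i).
    by rewrite !mxE opprB addrC subrK.
  exact: Bb.
Qed.

(** Writing generators of [J] as combinations of themselves with coefficients in [B] gives a
    singular matrix 1 - b, whose determinant is 1 modulo [B]. *)
Lemma ideal_nakayama (K : fieldExtType rat) (m : int) (J B : set K) :
  m != 0 -> is_ideal J -> J m%:~R -> is_ideal B ->
  J `<=` ideal_mul J B -> B 1.
Proof.
move=> m0 iJ Jm iB JJB.
have [n [c [Jc gen]]] := ideal_finitely_generated m0 iJ Jm.
have /choice[b hb] : forall i, exists b : 'I_n -> K,
    (forall j, B (b j)) /\ c i = \sum_j b j * c j.
  move=> i; move: (JJB _ (Jc i)); move: (c i).
  apply: (@ideal_mul_sub _ _ _ [set x | exists b : 'I_n -> K,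
    (forall j, B (b j)) /\ x = \sum_j b j * c j]).
  - exists (fun=> 0); split=> [j|]; first by case: iB.
    by rewrite big1// => j _; rewrite mul0r.
  - move=> x y [u [Bu ->]] [v [Bv ->]]; exists (fun j => u j + v j); split.
      by move=> j; exact: idealD.
    by rewrite -big_split; apply: eq_bigr => j _; rewrite mulrDl.
  - move=> x y /gen[o Oo ->] By; exists (fun j => o j * y); split.
      by move=> j; exact: idealZ.
    by rewrite mulr_suml; apply: eq_bigr => j _; rewrite mulrAC.
(* Transposed, because [det0P] asks for a row vector in the kernel. *)
pose M : 'M[K]_n := \matrix_(j, i) b i j.
have : \det (1%:M - M) == 0.
  apply/det0P; exists (\row_i c i).
    apply/eqP => c0; have [o _ mE] := gen _ Jm.
    move: m0; rewrite -(intr_fieldExt_eq0 K) mE big1 ?eqxx// => i _.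
    by move/rowP/(_ i): c0; rewrite !mxE => ->; rewrite mulr0.
  apply/rowP => i; rewrite mulmxBr mulmx1 !mxE.
  rewrite {1}(proj2 (hb i)); apply/eqP; rewrite subr_eq0; apply/eqP.
  by apply: eq_bigr => j _; rewrite !mxE mulrC.
move=> /eqP det0; have := @det_1sub_ideal _ B n M iB.
rewrite det0 subr0; apply => i j; rewrite mxE.
exact: (proj1 (hb j)).
Qed.

(** After division by [gamma], [B] fixes [L]: its elements stabilize [L], hence are integral, and
    Nakayama makes it the unit ideal. *)
Lemma ideal_mul_cancel_principal (K : fieldExtType rat) (m : int) (gamma : K)
    (L B : set K) : m != 0 -> is_ideal L -> L m%:~R -> is_ideal B ->
  gamma != 0 -> scale_set gamma L = ideal_mul L B -> B = principal_ideal gamma.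
Proof.
move=> m0 iL Lm iB g0 gL.
pose B' := scale_set gamma^-1 B.
have LB' : ideal_mul L B' = L.
  by rewrite ideal_mul_scaler -gL scale_setA mulVf// scale_set1.
have B'O : B' `<=` @ring_of_integers K.
  move=> x B'x; apply: (ideal_stabilizer_integral m0 iL Lm) => y Ly.
  by rewrite -LB' mulrC; exact: ideal_mul_mem.
have iB' : is_ideal B' by exact: is_ideal_scale.
have B'E : B' = @ring_of_integers K.
  apply: ideal_eq_roi => //; apply: (ideal_nakayama m0 iL Lm iB').
  by rewrite LB'.
by rewrite principal_idealE -B'E scale_setA mulfV// scale_set1.
Qed.

(** * Principal powers and divisibility *)

Lemma ideal_pow_principal (K : fieldExtType rat) (m : int) (J : set K) :
  m != 0 ->
  (forall A : set K, is_nonzero_ideal A -> exists (a : K) (L : set K),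
     [/\ a != 0, is_ideal L, L m%:~R & A = scale_set a L]) ->
  is_ideal J -> J m%:~R ->
  exists (k : nat) (gamma : K),
    gamma != 0 /\ ideal_pow J k.+1 = principal_ideal gamma.
Proof.
move=> m0 rep iJ Jm.
have mK : (m%:~R : K) != 0 by rewrite intr_fieldExt_eq0.
have /choice[f hf] : forall k, exists aL : K * set K,
    [/\ aL.1 != 0, is_ideal aL.2, aL.2 m%:~R &
        ideal_pow J k = scale_set aL.1 aL.2].
  move=> k; have [|a [L hL]] := rep (ideal_pow J k); last by exists (a, L).
  split; first exact: is_ideal_pow.
  move=> J0; have := ideal_pow_mem k Jm; rewrite J0 => /eqP.
  by rewrite expf_eq0 (negPf mK) andbF.
have [||i [j [lt_ij Lij]]] := @ideal_sequence_repeats K m (fun k => (f k).2) m0.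
- by move=> k; case: (hf k).
- by move=> k; case: (hf k).
have [ai0 iLi Lim iE] := hf i; have [aj0 _ _ jE] := hf j.
(* From J^i = a_i L and J^j = a_j L follows (a_j / a_i) L = L J^(j-i). *)
exists (j - i).-1, ((f i).1^-1 * (f j).1); split.
  by rewrite mulf_neq0// invr_eq0.
rewrite prednK ?subn_gt0//.
apply: (ideal_mul_cancel_principal m0 iLi Lim).
- exact: is_ideal_pow.
- by rewrite mulf_neq0// invr_eq0.
- rewrite -scale_setA [in LHS]Lij -jE -{1}(subnKC (ltnW lt_ij)) ideal_powD//.
  by rewrite iE ideal_mul_scalel scale_setA mulVf// scale_set1.
Qed.

Lemma ideal_dvd_of_mem (K : fieldExtType rat) (m : int) (J : set K) :
  m != 0 ->
  (forall A : set K, is_nonzero_ideal A -> exists (a : K) (L : set K),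
     [/\ a != 0, is_ideal L, L m%:~R & A = scale_set a L]) ->
  is_ideal J -> J m%:~R -> ideal_dvd J (principal_ideal (m%:~R : K)).
Proof.
move=> m0 rep iJ Jm.
have [k [g [g0 gE]]] := ideal_pow_principal m0 rep iJ Jm.
(* This cofactor is integral because m J^k lies in J^(k+1) = (g). *)
exists (scale_set (m%:~R / g) (ideal_pow J k)).
  apply: is_ideal_scale; first exact: is_ideal_pow.
  move=> _ [x Jx <-].
  have : ideal_pow J k.+1 (m%:~R * x) by exact: ideal_mul_mem.
  by rewrite gE => -[c Oc cE]; rewrite mulrAC -cE mulfK.
rewrite ideal_mul_scaler -[ideal_mul _ _]/(ideal_pow J k.+1) gE.
by rewrite !principal_idealE scale_setA divfK.
Qed.

(** * Representatives from the Euclidean hypothesis *)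

Lemma euclid_ideal_representative (K : fieldExtType rat) (M : {fset int})
    (M_nz : forall m : int, m \in M -> m != 0)
    (euclid : forall a b : K, ring_of_integers a -> ring_of_integers b ->
       b != 0 ->
       exists (q : K) (r : int), [/\ ring_of_integers q, r \in M &
         `|field_norm (r%:~R * a - q * b)| < `|field_norm b|])
    (A : set K) : is_nonzero_ideal A ->
  exists (a : K) (L : set K), [/\ a != 0, is_ideal L,
    L (\prod_(m <- M) m)%:~R & A = scale_set a L].
Proof.
move=> [iA An0]; have AO : A `<=` @ring_of_integers K by case: iA.
set P := \prod_(m <- M) m.
have P0 : (P%:~R : K) != 0.
  rewrite intr_fieldExt_eq0 prodf_seq_neq0; apply/allP => m mM.
  exact: M_nz.
pose Q n := `[< exists b, [/\ A b, b != 0 & `|field_norm b| = n%:R] >].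
have normQ b : A b -> b != 0 -> exists2 n, Q n & `|field_norm b| = n%:R.
  move=> Ab b0; have /natrP[n nE] : `|field_norm b| \is a Num.nat.
    by apply: natr_norm_int; apply: field_norm_int; exact: AO.
  by exists n => //; apply/asboolP; exists b.
have exQ : exists n, Q n.
  have [b Ab b0] : exists2 b, A b & b != 0.
    apply: contrapT => nb; apply: An0; rewrite eqEsubset; split=> x /=.
      by move=> Ax; apply/eqP/negPn/negP => x0; apply: nb; exists x.
    by move=> ->; case: iA.
  by have [n] := normQ b Ab b0; exists n.
case: (ex_minnP exQ) => n /asboolP[b [Ab b0 bn]] nmin.
have PA x : A x -> exists2 c, ring_of_integers c & P%:~R * x = c * b.
  move=> Ax; have [q [r [Oq rM]]] := euclid x b (AO _ Ax) (AO _ Ab) b0.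
  (* A nonzero remainder would lie in [A] with norm below the minimum, so r x = q b; the other
     factors of [P] then multiply [q]. *)
  have [|rq0] := eqVneq (r%:~R * x - q * b) 0; last first.
    have Arq : A (r%:~R * x - q * b).
      by apply: idealB => //; apply: idealZ => //; exact: roi_int.
    have [n' /nmin le_nn' ->] := normQ _ Arq rq0.
    by rewrite bn ltr_nat ltnNge le_nn'.
  move=> /eqP; rewrite subr_eq0 => /eqP rE _.
  exists ((\prod_(m <- M | m != r) m)%:~R * q).
    by apply: roiM => //; exact: roi_int.
  rewrite /P (bigD1_seq r) ?fset_uniq//= intrM -[RHS]mulrA -rE; ring.
(* [PA] makes (P / b) A integral, and it contains [P] because [b] lies in [A]. *)
exists (b / P%:~R), (scale_set (P%:~R / b) A); split.
- by rewrite mulf_neq0// invr_eq0.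
- apply: is_ideal_scale => // _ [x Ax <-].
  by have [c Oc cE] := PA x Ax; rewrite mulrAC cE mulfK.
- by exists b; rewrite ?divfK.
- by rewrite scale_setA mulrA divfK// mulfV// scale_set1.
Qed.

Theorem theorem4p1 (K : fieldExtType rat) (I : set K) (M : {fset int})
    (I_nz : is_nonzero_ideal I) (M_nz : forall m : int, m \in M -> m != 0)
    (euclid : forall a b : K, ring_of_integers a -> ring_of_integers b ->
       b != 0 ->
       exists (q : K) (r : int), [/\ ring_of_integers q, r \in M &
         `|field_norm (r%:~R * a - q * b)| < `|field_norm b|]) :
  exists J : set K, [/\ is_ideal J, ideal_equiv I J &
    ideal_dvd J (principal_ideal ((\prod_(m <- M) m)%:~R : K))].
Proof.
have rep := euclid_ideal_representative M_nz euclid.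
have [a [J [a0 iJ Jm IE]]] := rep I I_nz.
exists J; split=> //.
  by exists a => //; rewrite principal_idealE ideal_mul_scalel ideal_mul_roil.
apply: ideal_dvd_of_mem => //.
by rewrite prodf_seq_neq0; apply/allP => m mM; exact: M_nz.
Qed.
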